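(* (Superposition.) Let $\mathbf C$ be a cancellative atomic Markov category with conditionals. If $f:X\otimes W\to Y\otimes W$ is traceable and $g:X'\to Y'$ is any morphism, then $g\otimes f:X'\otimes X\otimes W\to Y'\otimes Y\otimes W$ is traceable (with respect to $W$), and $$\mathbf{tr}^W(g\otimes f)=g\otimes\mathbf{tr}^W(f).$$
   Context: A Markov category is a symmetric monoidal category $(\mathbf C,\otimes,I)$ in which every object $X$ carries a commutative comonoid $\Delta_X:X\to X\otimes X$, $\mathrm{del}_X:X\to I$, compatible with $\otimes$, and every $f:X\to Y$ satisfies $\mathrm{del}_Y\circ f=\mathrm{del}_X$. Naturality of $\Delta$ is not assumed. Coherence isomorphisms are suppressed. $\mathbf C$ has conditionals if for every $f:A\to X\otimes Y$ there is $f|_X:X\otimes A\to Y$ with $f=(\mathrm{id}_X\otimes f|_X)\circ(\Delta_X\otimes\mathrm{id}_A)\circ\big(((\mathrm{id}_X\otimes\mathrm{del}_Y)\circ f)\otimes\mathrm{id}_A\big)\circ\Delta_A$. For $p:A\to X$ and $f_1,f_2:W\otimes X\to Y$, write $f_1=_pf_2$ if $(f_1\otimes\mathrm{id}_X)\circ(\mathrm{id}_W\otimes(\Delta_X\circ p))=(f_2\otimes\mathrm{id}_X)\circ(\mathrm{id}_W\otimes(\Delta_X\circ p))$. For $p:A\to X$, $q:B\to X$ write $p\ll q$ if for all $W,Y$ and $f_1,f_2:W\otimes X\to Y$, $f_1=_qf_2$ implies $f_1=_pf_2$. $p:A\to X$ is atomic if $\Delta_X\circ p\ll p\otimes p$;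 $\mathbf C$ is atomic if all its morphisms are. An object $W$ is cancellable if $\mathrm{del}_W\otimes f_1=\mathrm{del}_W\otimes f_2$ implies $f_1=f_2$ for all parallel $f_1,f_2$; $\mathbf C$ is cancellative if all objects are cancellable. A morphism $f:X\otimes W'\to Y\otimes W$ is non-signalling (from $W'$ to $W$) if there is $f_s:X\to W$ with $(\mathrm{del}_Y\otimes\mathrm{id}_W)\circ f=f_s\otimes\mathrm{del}_{W'}$. A disintegration of $f$ is a pair $f_s:X\to W$, $f_p:X\otimes W\otimes W'\to Y$ with $f=(f_p\otimes\mathrm{id}_W)\circ(\mathrm{id}_{X\otimes W}\otimes\mathrm{swap}_{W,W'})\circ(s\otimes\mathrm{id}_{W'})$, where $s=(\mathrm{id}_X\otimes(\Delta_W\circ f_s))\circ\Delta_X:X\to X\otimes W\otimes W$. In a Markov category with conditionals, $f$ is non-signalling iff it has a disintegration. $f:X\otimes W\to Y\otimes W$ is called traceable (with respect to $W$) if it is non-signalling from the input $W$ to the output $W$; its causal trace is $\mathbf{tr}^W(f)=f_p\circ s:X\to Y$ for any disintegration (with $W'=W$); under the stated assumptions on $\mathbf C$ this does not depend on the choice of disintegration. *)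

(* Defs.v *)
From Stdlib Require Import ClassicalEpsilon.

Set Implicit Arguments.
Unset Strict Implicit.
Unset Printing Implicit Defensive.

Declare Scope cat_scope.
Local Open Scope cat_scope.

Record category := Category {
  obj :> Type;
  hom : obj -> obj -> Type;
  idm : forall A, hom A A;
  comp : forall A B D, hom B D -> hom A B -> hom A D;
  comp_idl : forall A B (f : hom A B), comp (idm B) f = f;
  comp_idr : forall A B (f : hom A B), comp f (idm A) = f;
  compA : forall A B D E (h : hom D E) (g : hom B D) (f : hom A B),
    comp h (comp g f) = comp (comp h g) f
}.

Arguments hom {c} A B.
Arguments idm {c} A.
Arguments comp {c A B D} g f.

Notation "A ~> B" := (hom A B) (at level 70, no associativity) : cat_scope.
Notation "g ∘ f" := (comp g f) (at level 40, left associativity) : cat_scope.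

(* Nothing is assumed strict: the associators and unitors that are suppressed
   in string-diagram notation are explicit.  [⊗] is the tensor of objects,
   [⊠] the tensor of morphisms. *)
Record symMonCat := SymMonCat {
  smc_cat :> category;
  munit : smc_cat;
  tens : smc_cat -> smc_cat -> smc_cat;
  tensm : forall A B A' B' : smc_cat,
    A ~> B -> A' ~> B' -> tens A A' ~> tens B B';
  assoc : forall A B D : smc_cat, tens (tens A B) D ~> tens A (tens B D);
  associ : forall A B D : smc_cat, tens A (tens B D) ~> tens (tens A B) D;
  lunit : forall A : smc_cat, tens munit A ~> A;
  luniti : forall A : smc_cat, A ~> tens munit A;
  runit : forall A : smc_cat, tens A munit ~> A;
  runiti : forall A : smc_cat, A ~> tens A munit;
  swap : forall A B : smc_cat, tens A B ~> tens B A;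

  tensm_id : forall A B : smc_cat,
    tensm (idm A) (idm B) = idm (tens A B);
  tensm_comp : forall (A B D A' B' D' : smc_cat)
    (g : B ~> D) (f : A ~> B) (g' : B' ~> D') (f' : A' ~> B'),
    tensm (g ∘ f) (g' ∘ f') = tensm g g' ∘ tensm f f';

  assocK : forall A B D : smc_cat, associ A B D ∘ assoc A B D = idm _;
  associK : forall A B D : smc_cat, assoc A B D ∘ associ A B D = idm _;
  lunitK : forall A : smc_cat, luniti A ∘ lunit A = idm _;
  lunitiK : forall A : smc_cat, lunit A ∘ luniti A = idm _;
  runitK : forall A : smc_cat, runiti A ∘ runit A = idm _;
  runitiK : forall A : smc_cat, runit A ∘ runiti A = idm _;
  swapK : forall A B : smc_cat, swap B A ∘ swap A B = idm _;

  assoc_nat : forall (A B D A' B' D' : smc_cat)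
    (f : A ~> A') (g : B ~> B') (h : D ~> D'),
    assoc A' B' D' ∘ tensm (tensm f g) h
    = tensm f (tensm g h) ∘ assoc A B D;
  lunit_nat : forall (A B : smc_cat) (f : A ~> B),
    lunit B ∘ tensm (idm munit) f = f ∘ lunit A;
  runit_nat : forall (A B : smc_cat) (f : A ~> B),
    runit B ∘ tensm f (idm munit) = f ∘ runit A;
  swap_nat : forall (A B A' B' : smc_cat) (f : A ~> A') (g : B ~> B'),
    swap A' B' ∘ tensm f g = tensm g f ∘ swap A B;

  pentagon : forall A B D E : smc_cat,
    assoc A B (tens D E) ∘ assoc (tens A B) D E
    = tensm (idm A) (assoc B D E)
      ∘ (assoc A (tens B D) E ∘ tensm (assoc A B D) (idm E));
  triangle : forall A B : smc_cat,
    tensm (idm A) (lunit B) ∘ assoc A munit B = tensm (runit A) (idm B);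
  hexagon : forall A B D : smc_cat,
    assoc B D A ∘ (swap A (tens B D) ∘ assoc A B D)
    = tensm (idm B) (swap A D)
      ∘ (assoc B A D ∘ tensm (swap A B) (idm D))
}.

Arguments munit {s}.
Arguments tens {s} A B.
Arguments tensm {s A B A' B'} f g.
Arguments assoc {s} A B D.
Arguments associ {s} A B D.
Arguments lunit {s} A.
Arguments luniti {s} A.
Arguments runit {s} A.
Arguments runiti {s} A.
Arguments swap {s} A B.

Notation "A ⊗ B" := (tens A B) (at level 36, left associativity) : cat_scope.
Notation "f ⊠ g" := (tensm f g) (at level 36, left associativity) : cat_scope.

Definition interchange (C : symMonCat) (A B D E : C) :
    (A ⊗ B) ⊗ (D ⊗ E) ~> (A ⊗ D) ⊗ (B ⊗ E) :=
  associ A D (B ⊗ E)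
  ∘ (idm A ⊠ (assoc D B E ∘ (swap B D ⊠ idm E) ∘ associ B D E))
  ∘ assoc A B (D ⊗ E).

(* The values of [copy] and [del] at the unit object are forced by the axioms
   below ([del munit = idm munit], [copy munit = luniti munit]). *)
Record markovCat := MarkovCat {
  markov_smc :> symMonCat;
  copy : forall X : markov_smc, X ~> X ⊗ X;
  del : forall X : markov_smc, X ~> munit;

  copy_assoc : forall X : markov_smc,
    assoc X X X ∘ (copy X ⊠ idm X) ∘ copy X = (idm X ⊠ copy X) ∘ copy X;
  copy_dell : forall X : markov_smc,
    lunit X ∘ (del X ⊠ idm X) ∘ copy X = idm X;
  copy_delr : forall X : markov_smc,
    runit X ∘ (idm X ⊠ del X) ∘ copy X = idm X;
  copy_swap : forall X : markov_smc, swap X X ∘ copy X = copy X;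

  copy_tens : forall X Y : markov_smc,
    copy (X ⊗ Y) = interchange X X Y Y ∘ (copy X ⊠ copy Y);
  del_tens : forall X Y : markov_smc,
    del (X ⊗ Y) = lunit munit ∘ (del X ⊠ del Y);

  del_nat : forall (X Y : markov_smc) (f : X ~> Y), del Y ∘ f = del X
}.

Arguments copy {m} X.
Arguments del {m} X.

Section MarkovNotions.
Variable C : markovCat.

Definition marginal1 (A X Y : C) (f : A ~> X ⊗ Y) : A ~> X :=
  runit X ∘ (idm X ⊠ del Y) ∘ f.

Definition marginal2 (A X Y : C) (f : A ~> X ⊗ Y) : A ~> Y :=
  lunit Y ∘ (del X ⊠ idm Y) ∘ f.

Definition is_conditional (A X Y : C) (f : A ~> X ⊗ Y) (c : X ⊗ A ~> Y) : Prop :=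
  f = (idm X ⊠ c) ∘ assoc X X A ∘ (copy X ⊠ idm A)
      ∘ (marginal1 f ⊠ idm A) ∘ copy A.

Definition has_conditionals : Prop :=
  forall (A X Y : C) (f : A ~> X ⊗ Y), exists c : X ⊗ A ~> Y, is_conditional f c.

Definition as_eq (A X W Y : C) (p : A ~> X) (f1 f2 : W ⊗ X ~> Y) : Prop :=
  (f1 ⊠ idm X) ∘ associ W X X ∘ (idm W ⊠ (copy X ∘ p))
  = (f2 ⊠ idm X) ∘ associ W X X ∘ (idm W ⊠ (copy X ∘ p)).

Definition abs_cont (A B X : C) (p : A ~> X) (q : B ~> X) : Prop :=
  forall (W Y : C) (f1 f2 : W ⊗ X ~> Y), as_eq q f1 f2 -> as_eq p f1 f2.

Definition atomic_mor (A X : C) (p : A ~> X) : Prop :=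
  abs_cont (copy X ∘ p) (p ⊠ p).

Definition atomic : Prop := forall (A X : C) (p : A ~> X), atomic_mor p.

Definition cancellable (W : C) : Prop :=
  forall (A B : C) (f1 f2 : A ~> B), del W ⊠ f1 = del W ⊠ f2 -> f1 = f2.

Definition cancellative : Prop := forall W : C, cancellable W.

Definition non_signalling (X W' Y W : C) (f : X ⊗ W' ~> Y ⊗ W) : Prop :=
  exists fs : X ~> W, marginal2 f = runit W ∘ (fs ⊠ del W').

Definition copy_signal (X W : C) (fs : X ~> W) : X ~> X ⊗ W ⊗ W :=
  associ X W W ∘ (idm X ⊠ (copy W ∘ fs)) ∘ copy X.

Definition is_disintegration (X W' Y W : C) (f : X ⊗ W' ~> Y ⊗ W)
    (fs : X ~> W) (fp : X ⊗ W ⊗ W' ~> Y) : Prop :=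
  f = (fp ⊠ idm W)
      ∘ (associ (X ⊗ W) W' W ∘ (idm (X ⊗ W) ⊠ swap W W') ∘ assoc (X ⊗ W) W W')
      ∘ (copy_signal fs ⊠ idm W').

Definition traceable (X Y W : C) (f : X ⊗ W ~> Y ⊗ W) : Prop :=
  non_signalling f.

Definition trace_value (X Y W : C) (f : X ⊗ W ~> Y ⊗ W) (t : X ~> Y) : Prop :=
  exists (fs : X ~> W) (fp : X ⊗ W ⊗ W ~> Y),
    is_disintegration f fs fp /\ t = fp ∘ copy_signal fs.

Lemma traceable_inhabited (X Y W : C) (f : X ⊗ W ~> Y ⊗ W) :
  traceable f -> inhabited (X ~> Y).
Proof.
intros [fs _]; constructor.
exact (marginal1 f ∘ (idm X ⊠ fs) ∘ copy X).
Qed.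

(* [f_p ∘ s] for a chosen disintegration.  One exists for every traceable [f]
   when [C] has conditionals; if there is none, the value is unspecified. *)
Definition causal_trace (X Y W : C) (f : X ⊗ W ~> Y ⊗ W) (hf : traceable f) :
    X ~> Y :=
  epsilon (traceable_inhabited hf) (trace_value f).

End MarkovNotions.

Arguments has_conditionals C : clear implicits.
Arguments atomic C : clear implicits.
Arguments cancellative C : clear implicits.
Arguments causal_trace {C X Y W} f hf.

(* Main.v *)
(** If [(fs, fp)] is a disintegration of [f], then [(fs ∘ pr2, g ⊠ fp)] is one of
    [g ⊠ f], and composing with the copied signal gives [g ⊠ tr f] at once.  The
    content is that the trace does not depend on the disintegration: [fs] is
    unique by cancellativity, and [fp] is pinned down far enough by atomicity.

    Coherence is handled through the pairing [pair f g = (f ⊠ g) ∘ copy]: the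
    deterministic morphisms form a cartesian category containing all structural
    ones, so equations between structural maps are checked on projections. *)

From Stdlib Require Import ssreflect ClassicalEpsilon.
Require Import Defs.

Set Implicit Arguments.
Unset Strict Implicit.
Unset Printing Implicit Defensive.

Local Open Scope cat_scope.

(** * Coherence in symmetric monoidal categories *)

Lemma tensm_comp_idl (C : symMonCat) (Z A B D : C) (g : B ~> D) (f : A ~> B) :
  idm Z ⊠ (g ∘ f) = (idm Z ⊠ g) ∘ (idm Z ⊠ f).
Proof. by rewrite -tensm_comp comp_idl. Qed.

Lemma tensm_comp_idr (C : symMonCat) (Z A B D : C) (g : B ~> D) (f : A ~> B) :
  (g ∘ f) ⊠ idm Z = (g ⊠ idm Z) ∘ (f ⊠ idm Z).
Proof. by rewrite -tensm_comp comp_idl. Qed.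

Lemma tensm_splitl (C : symMonCat) (A B A' B' : C) (f : A ~> B) (g : A' ~> B') :
  f ⊠ g = (f ⊠ idm B') ∘ (idm A ⊠ g).
Proof. by rewrite -tensm_comp comp_idl comp_idr. Qed.

Lemma tensm_splitr (C : symMonCat) (A B A' B' : C) (f : A ~> B) (g : A' ~> B') :
  f ⊠ g = (idm B ⊠ g) ∘ (f ⊠ idm A').
Proof. by rewrite -tensm_comp comp_idl comp_idr. Qed.

Lemma split_mono (C : category) (A B D : C) (i : B ~> D) (r : D ~> B)
    (f g : A ~> B) :
  r ∘ i = idm B -> i ∘ f = i ∘ g -> f = g.
Proof. by move=> ri fg; rewrite -(comp_idl f) -ri -compA fg compA ri comp_idl. Qed.

Lemma split_epi (C : category) (A B D : C) (p : A ~> B) (s : B ~> A)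
    (f g : B ~> D) :
  p ∘ s = idm B -> f ∘ p = g ∘ p -> f = g.
Proof. by move=> ps fg; rewrite -(comp_idr f) -ps compA fg -compA ps comp_idr. Qed.

Lemma associ_nat (C : symMonCat) (A B D A' B' D' : C)
    (f : A ~> A') (g : B ~> B') (h : D ~> D') :
  associ A' B' D' ∘ (f ⊠ (g ⊠ h)) = ((f ⊠ g) ⊠ h) ∘ associ A B D.
Proof.
apply: (split_mono (assocK A' B' D')).
by rewrite !compA assoc_nat associK comp_idl -compA associK comp_idr.
Qed.

Lemma munit_tensl_inj (C : symMonCat) (A B : C) (f g : A ~> B) :
  idm munit ⊠ f = idm munit ⊠ g -> f = g.
Proof.
move=> fg; apply: (split_epi (lunitiK A)).
by rewrite -!lunit_nat fg.
Qed.

Lemma munit_tensr_inj (C : symMonCat) (A B : C) (f g : A ~> B) :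
  f ⊠ idm munit = g ⊠ idm munit -> f = g.
Proof.
move=> fg; apply: (split_epi (runitiK A)).
by rewrite -!runit_nat fg.
Qed.

(* Kelly's redundancy of the unit axioms: the pentagon at
   [(munit, munit, A, B)], after tensoring with [munit]. *)
Lemma lunit_tens (C : symMonCat) (A B : C) :
  lunit (A ⊗ B) ∘ assoc munit A B = lunit A ⊠ idm B.
Proof.
apply: munit_tensl_inj.
apply: (split_epi (associK munit (munit ⊗ A) B)).
apply: (split_epi (p := assoc munit munit A ⊠ idm B) (s := associ munit munit A ⊠ idm B)).
  by rewrite -tensm_comp_idr associK tensm_id.
rewrite tensm_comp_idl -!compA -pentagon !compA triangle.
rewrite -assoc_nat -(compA (assoc _ _ _)) -tensm_comp_idr triangle.
by rewrite assoc_nat tensm_id.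
Qed.

(** Mirror argument: the pentagon at [(A, B, munit, munit)], after tensoring with [munit] on the
    right. *)
Lemma runit_tens (C : symMonCat) (A B : C) :
  (idm A ⊠ runit B) ∘ assoc A B munit = runit (A ⊗ B).
Proof.
apply: munit_tensr_inj.
rewrite tensm_comp_idr -triangle.
apply: (split_mono (assocK A B munit)).
rewrite !compA assoc_nat -triangle tensm_comp_idl -!compA -pentagon.
by rewrite -tensm_id !compA assoc_nat.
Qed.

(** The hexagon at [(A, munit, munit)], after tensoring with [munit] and composing with the
    invertible [swap A munit]. *)
Lemma lunit_swap (C : symMonCat) (A : C) : lunit A ∘ swap A munit = runit A.
Proof.
apply: munit_tensr_inj.
apply: (split_mono (swapK A munit)).
rewrite tensm_comp_idr -lunit_tens !compA -lunit_nat -!compA -hexagon.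
by rewrite (compA (lunit _)) lunit_tens compA -swap_nat -compA triangle.
Qed.

Lemma runit_swap (C : symMonCat) (A : C) : runit A ∘ swap munit A = lunit A.
Proof. by rewrite -lunit_swap -compA swapK comp_idr. Qed.

Lemma triangle_inv (C : symMonCat) (A B : C) :
  (runit A ⊠ idm B) ∘ associ A munit B = idm A ⊠ lunit B.
Proof. by rewrite -triangle -compA associK comp_idr. Qed.

Lemma lunit_tens_inv (C : symMonCat) (A B : C) :
  (lunit A ⊠ idm B) ∘ associ munit A B = lunit (A ⊗ B).
Proof. by rewrite -lunit_tens -compA associK comp_idr. Qed.

Definition middle_swap (C : symMonCat) (A B D : C) : A ⊗ (B ⊗ D) ~> B ⊗ (A ⊗ D) :=
  assoc B A D ∘ (swap A B ⊠ idm D) ∘ associ A B D.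

Lemma middle_swap_nat (C : symMonCat) (A B D A' B' D' : C)
    (f : A ~> A') (g : B ~> B') (h : D ~> D') :
  middle_swap A' B' D' ∘ (f ⊠ (g ⊠ h)) = (g ⊠ (f ⊠ h)) ∘ middle_swap A B D.
Proof.
rewrite /middle_swap -compA associ_nat compA -(compA (assoc _ _ _)).
rewrite -tensm_comp swap_nat comp_idl -{1}(comp_idr h) tensm_comp.
by rewrite !compA assoc_nat.
Qed.

Lemma interchangeE (C : symMonCat) (A B D E : C) :
  interchange A B D E
  = associ A D (B ⊗ E) ∘ (idm A ⊠ middle_swap B D E) ∘ assoc A B (D ⊗ E).
Proof. by []. Qed.

Lemma interchange_nat (C : symMonCat) (A B D E A' B' D' E' : C)
    (f : A ~> A') (g : B ~> B') (h : D ~> D') (k : E ~> E') :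
  interchange A' B' D' E' ∘ ((f ⊠ g) ⊠ (h ⊠ k))
  = ((f ⊠ h) ⊠ (g ⊠ k)) ∘ interchange A B D E.
Proof.
rewrite !interchangeE -compA assoc_nat compA -(compA (associ _ _ _)).
rewrite -tensm_comp comp_idl middle_swap_nat -{1}(comp_idr f) tensm_comp.
by rewrite !compA associ_nat.
Qed.

(** * Terminality of the unit, projections and pairing *)

Lemma del_munit (C : markovCat) : del munit = idm (munit : C).
Proof.
(* Both sides become [del (munit ⊗ munit)] after [lunit munit]. With this equation the counit law
   turns into [del munit = idm munit]. *)
have e : (idm (munit : C) ⊠ del munit) = del munit ⊠ del munit.
  by apply: (split_mono (lunitK munit)); rewrite lunit_nat -del_tens del_nat.
have r := copy_delr (munit : C).
have := r; rewrite e tensm_splitl.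
by rewrite compA runit_nat -(compA (del _)) -(compA (del _)) r comp_idr.
Qed.

Lemma munit_terminal (C : markovCat) (A : C) (f g : A ~> munit) : f = g.
Proof. by rewrite -(comp_idl f) -(comp_idl g) -del_munit !del_nat. Qed.

Lemma munit2_terminal (C : markovCat) (A : C) (f g : A ~> munit ⊗ munit) : f = g.
Proof. by apply: (split_mono (lunitK munit)); apply: munit_terminal. Qed.

(* Locked so that [compA] does not match the compositions inside. *)
Definition pr1 (C : markovCat) (A B : C) : A ⊗ B ~> A :=
  locked (runit A ∘ (idm A ⊠ del B)).

Definition pr2 (C : markovCat) (A B : C) : A ⊗ B ~> B :=
  locked (lunit B ∘ (del A ⊠ idm B)).

Arguments pr1 {C A B}.
Arguments pr2 {C A B}.

Definition pair (C : markovCat) (G A B : C) (f : G ~> A) (g : G ~> B) : G ~> A ⊗ B :=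
  locked ((f ⊠ g) ∘ copy G).

Lemma pr1E (C : markovCat) (A B : C) : @pr1 C A B = runit A ∘ (idm A ⊠ del B).
Proof. by rewrite /pr1 -lock. Qed.

Lemma pr2E (C : markovCat) (A B : C) : @pr2 C A B = lunit B ∘ (del A ⊠ idm B).
Proof. by rewrite /pr2 -lock. Qed.

Lemma pairE (C : markovCat) (G A B : C) (f : G ~> A) (g : G ~> B) :
  pair f g = (f ⊠ g) ∘ copy G.
Proof. by rewrite /pair -lock. Qed.


(** Known as determinism of [f]: [copy] is natural at [f], which a Markov category does not grant in
    general. *)
Definition det (C : markovCat) (A B : C) (f : A ~> B) : Prop :=
  copy B ∘ f = (f ⊠ f) ∘ copy A.

Lemma pr1_tensm (C : markovCat) (A B A' B' : C) (f : A ~> B) (g : A' ~> B') :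
  pr1 ∘ (f ⊠ g) = f ∘ pr1.
Proof.
rewrite !pr1E -compA -tensm_comp comp_idl del_nat.
by rewrite (tensm_splitl f) !compA runit_nat.
Qed.

Lemma pr2_tensm (C : markovCat) (A B A' B' : C) (f : A ~> B) (g : A' ~> B') :
  pr2 ∘ (f ⊠ g) = g ∘ pr2.
Proof.
rewrite !pr2E -compA -tensm_comp comp_idl del_nat.
by rewrite (tensm_splitr (del A)) !compA lunit_nat.
Qed.

Lemma pr1_pair (C : markovCat) (G A B : C) (f : G ~> A) (g : G ~> B) :
  pr1 ∘ pair f g = f.
Proof. by rewrite !pairE compA pr1_tensm -compA pr1E copy_delr comp_idr. Qed.

Lemma pr2_pair (C : markovCat) (G A B : C) (f : G ~> A) (g : G ~> B) :
  pr2 ∘ pair f g = g.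
Proof. by rewrite !pairE compA pr2_tensm -compA pr2E copy_dell comp_idr. Qed.

Lemma tensm_pair (C : markovCat) (G A B A' B' : C)
    (h : A ~> A') (k : B ~> B') (f : G ~> A) (g : G ~> B) :
  (h ⊠ k) ∘ pair f g = pair (h ∘ f) (k ∘ g).
Proof. by rewrite !pairE compA tensm_comp. Qed.

Lemma swap_pair (C : markovCat) (G A B : C) (f : G ~> A) (g : G ~> B) :
  swap A B ∘ pair f g = pair g f.
Proof. by rewrite !pairE compA swap_nat -compA copy_swap. Qed.

Lemma assoc_pair (C : markovCat) (G A B D : C) (f : G ~> A) (g : G ~> B) (h : G ~> D) :
  assoc A B D ∘ pair (pair f g) h = pair f (pair g h).
Proof.
rewrite !pairE -{1}(comp_idr h) -{2}(comp_idr f) !tensm_comp !compA assoc_nat.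
by rewrite -!compA (compA (assoc _ _ _)) copy_assoc.
Qed.

Lemma associ_pair (C : markovCat) (G A B D : C) (f : G ~> A) (g : G ~> B) (h : G ~> D) :
  associ A B D ∘ pair f (pair g h) = pair (pair f g) h.
Proof. by rewrite -assoc_pair compA assocK comp_idl. Qed.

Lemma middle_swap_pair (C : markovCat) (G A B D : C)
    (f : G ~> A) (g : G ~> B) (h : G ~> D) :
  middle_swap A B D ∘ pair f (pair g h) = pair g (pair f h).
Proof.
by rewrite /middle_swap -!compA associ_pair tensm_pair swap_pair comp_idl assoc_pair.
Qed.

Lemma interchange_pair (C : markovCat) (G A B D E : C)
    (f : G ~> A) (g : G ~> B) (h : G ~> D) (k : G ~> E) :
  interchange A B D E ∘ pair (pair f g) (pair h k)
  = pair (pair f h) (pair g k).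
Proof.
rewrite interchangeE -!compA assoc_pair tensm_pair comp_idl middle_swap_pair.
by rewrite associ_pair.
Qed.

(** * Deterministic morphisms *)

Lemma pair_comp (C : markovCat) (G H A B : C) (f : G ~> A) (g : G ~> B) (d : H ~> G) :
  det d -> pair f g ∘ d = pair (f ∘ d) (g ∘ d).
Proof. by rewrite /det !pairE -compA tensm_comp -compA => ->. Qed.

Lemma det_idm (C : markovCat) (A : C) : det (idm A).
Proof. by rewrite /det tensm_id comp_idl comp_idr. Qed.

Lemma det_comp (C : markovCat) (A B D : C) (g : B ~> D) (f : A ~> B) :
  det g -> det f -> det (g ∘ f).
Proof.
rewrite /det => dg df.
by rewrite compA dg -compA df compA -tensm_comp.
Qed.

Lemma det_tensm (C : markovCat) (A B A' B' : C) (f : A ~> B) (g : A' ~> B') :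
  det f -> det g -> det (f ⊠ g).
Proof.
rewrite /det => df dg.
rewrite !copy_tens -compA -tensm_comp df dg tensm_comp.
by rewrite compA interchange_nat -compA.
Qed.

Lemma det_copy (C : markovCat) (A : C) : det (copy A).
Proof.
have e : copy A = pair (idm A) (idm A) by rewrite pairE tensm_id comp_idl.
by rewrite /det copy_tens -compA -pairE e interchange_pair.
Qed.

(** Serves determinism of [runit]: by [copy_tens], copying [A ⊗ munit] produces an [interchange]
    whose middle swap crosses a unit wire, so the unitors absorb it. *)
Lemma runit_interchange (C : markovCat) (A B : C) :
  (runit A ⊠ runit B) ∘ interchange A B munit munit
  = runit (A ⊗ B) ∘ (idm (A ⊗ B) ⊠ lunit munit).
Proof.
have l : lunit (B ⊗ munit) ∘ middle_swap B munit munit = idm B ⊠ lunit munit.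
  by rewrite /middle_swap !compA lunit_tens -tensm_comp_idr lunit_swap triangle_inv.
rewrite tensm_splitr interchangeE -!compA (compA (runit A ⊠ _)) triangle_inv.
rewrite (compA (idm A ⊠ lunit _)) -tensm_comp_idl l -assoc_nat tensm_id.
by rewrite compA runit_tens.
Qed.

Lemma lunit_interchange (C : markovCat) (A B : C) :
  (lunit A ⊠ lunit B) ∘ interchange munit munit A B
  = lunit (A ⊗ B) ∘ (lunit munit ⊠ idm (A ⊗ B)).
Proof.
have l : (idm A ⊠ lunit B) ∘ middle_swap munit A B = lunit (A ⊗ B).
  rewrite /middle_swap !compA triangle -tensm_comp_idr runit_swap.
  exact: lunit_tens_inv.
have r : runit munit = lunit (munit : C) by apply: munit_terminal.
rewrite tensm_splitl interchangeE -!compA -tensm_id (compA (_ ⊠ lunit B)).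
rewrite -associ_nat -!compA (compA (idm munit ⊠ _)) -tensm_comp_idl l.
by rewrite compA lunit_tens_inv triangle r.
Qed.

Lemma det_pr1 (C : markovCat) (A B : C) : det (@pr1 C A B).
Proof.
have dr : det (runit A).
  have c : copy munit = runiti (munit : C) by apply: munit2_terminal.
  rewrite /det copy_tens compA runit_interchange -compA -tensm_comp comp_idl.
  rewrite -runit_nat; congr (_ ∘ (_ ⊠ _)); apply: munit_terminal.
rewrite pr1E; apply: det_comp dr _; apply: det_tensm (det_idm _) _.
exact: munit2_terminal.
Qed.

Lemma det_pr2 (C : markovCat) (A B : C) : det (@pr2 C A B).
Proof.
have dl : det (lunit B).
  rewrite /det copy_tens compA lunit_interchange -compA -tensm_comp comp_idl.
  rewrite -lunit_nat; congr (_ ∘ (_ ⊠ _)); apply: munit_terminal.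
rewrite pr2E; apply: det_comp dl _; apply: det_tensm _ (det_idm _).
exact: munit2_terminal.
Qed.

(** [(pr1 ⊠ pr2) ∘ copy] is the identity, because deleting the crossed wires leaves [interchange] at
    two units, which is trivial. The equation thus covers non-deterministic [f] and [g] too. *)
Lemma tensm_pairE (C : markovCat) (A B A' B' : C) (f : A ~> B) (g : A' ~> B') :
  f ⊠ g = pair (f ∘ pr1) (g ∘ pr2).
Proof.
have p : (@pr1 C A A' ⊠ @pr2 C A A') ∘ copy (A ⊗ A') = idm (A ⊗ A').
  rewrite pr1E pr2E tensm_comp copy_tens -compA (compA _ (interchange _ _ _ _)).
  rewrite -interchange_nat.
  have -> : interchange A munit munit A' = idm _.
    rewrite interchangeE /middle_swap.
    have -> : swap munit munit = idm (munit ⊗ munit : C) by apply: munit2_terminal.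
    by rewrite tensm_id comp_idr associK tensm_id comp_idr assocK.
  by rewrite comp_idl -!tensm_comp !compA copy_delr copy_dell tensm_id.
by rewrite pairE tensm_comp -compA p comp_idr.
Qed.

Lemma pair_eta (C : markovCat) (A B : C) : pair pr1 pr2 = idm (A ⊗ B : C).
Proof. by rewrite -tensm_id tensm_pairE !comp_idl. Qed.

Lemma det_pair (C : markovCat) (G A B : C) (f : G ~> A) (g : G ~> B) :
  det f -> det g -> det (pair f g).
Proof.
move=> df dg; rewrite pairE; apply: det_comp (det_copy _).
exact: det_tensm.
Qed.

(** In general marginals do not determine a joint morphism; among deterministic morphisms they do,
    since [pair pr1 pr2 = idm] can be pulled through them. The tactic [struct] iterates this. *)
Lemma det_ext (C : markovCat) (G A B : C) (f g : G ~> A ⊗ B) :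
  det f -> det g -> pr1 ∘ f = pr1 ∘ g -> pr2 ∘ f = pr2 ∘ g -> f = g.
Proof.
move=> df dg e1 e2; rewrite -(comp_idl f) -(comp_idl g) -pair_eta.
by rewrite !pair_comp // e1 e2.
Qed.

#[local] Hint Resolve det_idm det_comp det_tensm det_copy det_pr1 det_pr2 det_pair : core.

(** * Structural maps as pairings *)

Lemma swapE (C : markovCat) (A B : C) : swap A B = pair pr2 pr1.
Proof. by rewrite -swap_pair pair_eta comp_idr. Qed.

Lemma assocE (C : markovCat) (A B D : C) :
  assoc A B D = pair (pr1 ∘ pr1) (pair (pr2 ∘ pr1) pr2).
Proof.
rewrite -assoc_pair -pair_comp //.
by rewrite pair_eta comp_idl pair_eta comp_idr.
Qed.

Lemma associE (C : markovCat) (A B D : C) :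
  associ A B D = pair (pair pr1 (pr1 ∘ pr2)) (pr2 ∘ pr2).
Proof.
rewrite -associ_pair -pair_comp //.
by rewrite pair_eta comp_idl pair_eta comp_idr.
Qed.

Lemma copyE (C : markovCat) (A : C) : copy A = pair (idm A) (idm A).
Proof. by rewrite pairE tensm_id comp_idl. Qed.

Lemma pr1_pairA (C : markovCat) (H G A B : C) (f : G ~> A) (g : G ~> B) (m : H ~> G) :
  pr1 ∘ (pair f g ∘ m) = f ∘ m.
Proof. by rewrite compA pr1_pair. Qed.

Lemma pr2_pairA (C : markovCat) (H G A B : C) (f : G ~> A) (g : G ~> B) (m : H ~> G) :
  pr2 ∘ (pair f g ∘ m) = g ∘ m.
Proof. by rewrite compA pr2_pair. Qed.

Ltac det_solve := solve [auto 30].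

Ltac struct_norm :=
  rewrite ?(swapE, assocE, associE, copyE, tensm_pairE) -?compA;
  repeat first
    [ rewrite pr1_pairA | rewrite pr2_pairA | rewrite pr1_pair | rewrite pr2_pair
    | rewrite comp_idl | rewrite comp_idr
    | rewrite pair_comp; [|det_solve] | rewrite pair_comp; [det_solve|] | rewrite -compA].

Ltac struct := solve [
  struct_norm; try reflexivity;
  repeat (apply: det_ext; [det_solve|det_solve|struct_norm|struct_norm]; try reflexivity)].

(** * Copying wires past arbitrary morphisms *)

(* Copying a wire commutes with whatever happens on the other wires.  This is the
   substitute for naturality of [pair], which fails for non-deterministic maps. *)
Lemma pair_pr2_tensm (C : markovCat) (A A' B U : C) (k : A ~> A') (u : A' ⊗ B ~> U) :
  pair u pr2 ∘ (k ⊠ idm B) = pair (u ∘ (k ⊠ idm B)) pr2.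
Proof.
have e (D : C) : pair (idm (D ⊗ B)) pr2 = associ D B B ∘ (idm D ⊠ copy B) by struct.
have s : pair (idm (A' ⊗ B)) pr2 ∘ (k ⊠ idm B) = pair (k ⊠ idm B) pr2.
  rewrite e -compA -tensm_splitr tensm_splitl -{1}(tensm_id B B) compA associ_nat.
  by rewrite -compA -e tensm_pair comp_idl comp_idr.
by rewrite -{1}(comp_idr u) -{1}(comp_idl pr2) -tensm_pair -compA s tensm_pair comp_idl.
Qed.

(** Reading [X] off the graph of [k] amounts to copying the input beforehand: coassociativity and
    cocommutativity move the copied wire past [k], which may be non-deterministic. *)
Lemma pair_pr1_graph (C : markovCat) (X W U : C) (k : X ~> W) (u : X ⊗ W ~> U) :
  pair u pr1 ∘ pair (idm X) k = pair (u ∘ pair (idm X) k) (idm X).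
Proof.
have s : pair (idm (X ⊗ W)) pr1 ∘ pair (idm X) k = pair (pair (idm X) k) (idm X).
  transitivity (associ X W X ∘ (idm X ⊠ swap X W) ∘ assoc X X W ∘ (copy X ⊠ idm W)
    ∘ pair (idm X) k); first by congr (_ ∘ _); struct.
  rewrite -!compA tensm_pair copyE !comp_idl comp_idr assoc_pair tensm_pair.
  by rewrite comp_idl swap_pair associ_pair.
by rewrite -{1}(comp_idr u) -{1}(comp_idl pr1) -tensm_pair -compA s tensm_pair comp_idl.
Qed.

(** * Disintegrations and almost sure equality *)

Lemma copy_signalE (C : markovCat) (X W : C) (k : X ~> W) :
  copy_signal k = pair (idm (X ⊗ W)) pr2 ∘ pair (idm X) k.
Proof.
rewrite /copy_signal -compA -pairE -(comp_idl (idm X)) -tensm_pair compA comp_idl.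
congr (_ ∘ _); struct.
Qed.

(** The copy of the signal that becomes the output [W] is read off the graph by [pr2 ∘ pr1], which
    turns the string diagram into one pairing. *)
Lemma disintegrationE (C : markovCat) (X W' Y W : C) (f : X ⊗ W' ~> Y ⊗ W)
    (fs : X ~> W) (fp : X ⊗ W ⊗ W' ~> Y) :
  is_disintegration f fs fp
  <-> f = pair fp (pr2 ∘ pr1) ∘ (pair (idm X) fs ⊠ idm W').
Proof.
rewrite /is_disintegration copy_signalE tensm_comp_idr.
have e : associ (X ⊗ W) W' W ∘ (idm (X ⊗ W) ⊠ swap W W') ∘ assoc (X ⊗ W) W W'
  ∘ (pair (idm (X ⊗ W)) pr2 ⊠ idm W') = pair (idm _) (pr2 ∘ pr1).
  struct.
rewrite -{1}(compA (fp ⊠ _)) (compA (associ _ _ _ ∘ _ ∘ _)) e compA tensm_pair.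
by rewrite comp_idl comp_idr.
Qed.

Lemma pair_pr1_graph_tensm (C : markovCat) (X W B U : C) (k : X ~> W)
    (u : X ⊗ W ⊗ B ~> U) :
  pair u (pr1 ∘ pr1) ∘ (pair (idm X) k ⊠ idm B)
  = pair (u ∘ (pair (idm X) k ⊠ idm B)) pr1.
Proof.
(* [r] lets the copied wire and the spectator [B] trade places, which reduces the claim to
   [pair_pr1_graph]. *)
pose r (D E : C) := associ D B E ∘ (idm D ⊠ swap E B) ∘ assoc D E B.
have r_nat (D D' E : C) (f : D ~> D') :
    r D' E ∘ ((f ⊠ idm E) ⊠ idm B) = ((f ⊠ idm B) ⊠ idm E) ∘ r D E.
  rewrite /r -compA assoc_nat tensm_id !compA -(compA (associ _ _ _)) -tensm_splitr.
  by rewrite tensm_splitl compA -{1}(tensm_id B E) associ_nat.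
have e : pair (idm (X ⊗ W ⊗ B)) (pr1 ∘ pr1) = r (X ⊗ W) X ∘ (pair (idm _) pr1 ⊠ idm B).
  by rewrite /r; struct.
have s : pair (idm _) (pr1 ∘ pr1) ∘ (pair (idm X) k ⊠ idm B)
         = pair (pair (idm X) k ⊠ idm B) pr1.
  rewrite e -compA -tensm_comp_idr pair_pr1_graph comp_idl.
  have -> : pair (pair (idm X) k) (idm X)
            = (pair (idm X) k ⊠ idm X) ∘ pair (idm X) (idm X).
    by rewrite tensm_pair comp_idl comp_idr.
  rewrite tensm_comp_idr compA r_nat -compA.
  have -> : r X X ∘ (pair (idm X) (idm X) ⊠ idm B) = pair (idm (X ⊗ B)) pr1.
    by rewrite /r; struct.
  by rewrite tensm_pair comp_idr comp_idl.
rewrite -{1}(comp_idr u) -{1}(comp_idl (pr1 ∘ pr1)) -tensm_pair -compA s tensm_pair.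
by rewrite comp_idl.
Qed.

Lemma as_eqE (C : markovCat) (A X W Y : C) (p : A ~> X) (f1 f2 : W ⊗ X ~> Y) :
  as_eq p f1 f2 <-> pair f1 pr2 ∘ (idm W ⊠ p) = pair f2 pr2 ∘ (idm W ⊠ p).
Proof.
have e (f : W ⊗ X ~> Y) : (f ⊠ idm X) ∘ associ W X X ∘ (idm W ⊠ (copy X ∘ p))
                          = pair f pr2 ∘ (idm W ⊠ p).
  rewrite tensm_comp_idl -!compA (compA (associ _ _ _)).
  have -> : associ W X X ∘ (idm W ⊠ copy X) = pair (idm _) pr2 by struct.
  by rewrite compA tensm_pair comp_idr comp_idl.
by rewrite /as_eq !e.
Qed.

(** * Uniqueness of the trace *)

Lemma cancel_pr1 (C : markovCat) (W A B : C) (f g : A ~> B) :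
  cancellable W -> f ∘ @pr1 C A W = g ∘ pr1 -> f = g.
Proof.
move=> cW fg; apply: cW; rewrite !tensm_pairE.
(* [cancellable] discards [W] on the left; the swap carries the hypothesis over. *)
have -> : pr2 = pr1 ∘ swap W A by rewrite swapE pr1_pair.
by rewrite !compA fg.
Qed.

Lemma disintegration_signal (C : markovCat) (X W' Y W : C) (f : X ⊗ W' ~> Y ⊗ W)
    (fs : X ~> W) (fp : X ⊗ W ⊗ W' ~> Y) :
  is_disintegration f fs fp -> pr2 ∘ f = fs ∘ pr1.
Proof.
move=> /disintegrationE ->.
by rewrite compA pr2_pair -compA pr1_tensm compA pr2_pair.
Qed.

(** Both sides are computed from [pair f pr1]: the signal is an output of [f], and the [X] kept by
    the graph is the input [X]. So [fp1] and [fp2] agree almost surely for the graph of [fs], with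
    [W'] as a free input. *)
Lemma disintegration_unique (C : markovCat) (X W' Y W : C) (f : X ⊗ W' ~> Y ⊗ W)
    (fs : X ~> W) (fp1 fp2 : X ⊗ W ⊗ W' ~> Y) :
  is_disintegration f fs fp1 -> is_disintegration f fs fp2 ->
  pair fp1 pr1 ∘ (pair (idm X) fs ⊠ idm W') = pair fp2 pr1 ∘ (pair (idm X) fs ⊠ idm W').
Proof.
move=> /disintegrationE e1 /disintegrationE e2.
have e (fp : X ⊗ W ⊗ W' ~> Y) : f = pair fp (pr2 ∘ pr1) ∘ (pair (idm X) fs ⊠ idm W') ->
    pair fp pr1 ∘ (pair (idm X) fs ⊠ idm W')
    = (idm Y ⊠ swap W X) ∘ assoc Y W X ∘ pair f pr1.
  move=> ->; rewrite -pair_pr1_graph_tensm compA -(compA _ (assoc _ _ _)) assoc_pair.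
  by rewrite tensm_pair swap_pair comp_idl -pair_comp // pair_eta comp_idl.
by rewrite (e _ e1) (e _ e2).
Qed.

(* For [s = (id, fs)], two disintegrations agree [s]-almost surely when the traced
   input is independent of [s], in particular when it comes from a second copy
   of [s].  By atomicity, [copy ∘ s ≪ s ⊗ s], so they still agree when both
   copies of the signal coincide, as they do in the trace. *)
Lemma trace_unique (C : markovCat) (X Y W : C) (f : X ⊗ W ~> Y ⊗ W) (fs : X ~> W)
    (fp1 fp2 : X ⊗ W ⊗ W ~> Y) :
  atomic_mor (pair (idm X) fs) ->
  is_disintegration f fs fp1 -> is_disintegration f fs fp2 ->
  fp1 ∘ copy_signal fs = fp2 ∘ copy_signal fs.
Proof.
move=> at_s d1 d2; have e12 := disintegration_unique d1 d2.
set s := pair (idm X) fs in at_s e12 *; rewrite !copy_signalE -/s.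
(* [munit] fills the parameter slot of [as_eq]. [h fp] feeds [fp] the first copy of [s] whole and,
   as traced input, only the [W] part of the second. *)
pose h (fp : X ⊗ W ⊗ W ~> Y) : munit ⊗ (X ⊗ W ⊗ (X ⊗ W)) ~> Y :=
  fp ∘ (idm _ ⊠ pr2) ∘ pr2.
have /at_s/as_eqE e : as_eq (s ⊠ s) (h fp1) (h fp2).
  apply/as_eqE.
  (* With independent copies of [s], the result depends on [fp] only through
     [pair fp pr1 ∘ (s ⊠ idm W)], where [fp1] and [fp2] agree. *)
  have e fp : pair (h fp) pr2 ∘ (idm munit ⊠ (s ⊠ s))
    = assoc _ _ _ ∘ pair (pair fp pr1 ∘ (s ⊠ idm W) ∘ (idm X ⊠ pr2)) pr2
      ∘ (idm X ⊠ s) ∘ pr2.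
    rewrite -(compA _ (s ⊠ _)) -tensm_splitl (tensm_splitr s pr2) compA.
    have -> : pair fp pr1 ∘ (idm (X ⊗ W) ⊠ pr2)
      = pair (fp ∘ (idm (X ⊗ W) ⊠ @pr2 C X W)) pr1.
      by rewrite pair_comp ?pr1_tensm ?comp_idl; auto.
    rewrite -pair_pr2_tensm compA assoc_pair pair_eta -(compA _ (s ⊠ _)) -tensm_splitl.
    rewrite -(compA (pair _ _)) -(pr2_tensm (idm munit)) compA.
    by rewrite (pair_comp _ _ (det_pr2 _ _)) comp_idl.
  by rewrite !e e12.
(* The trace is the first output when [h fp] is run on the duplicated [s], the situation that
   atomicity controls. *)
have t fp : fp ∘ (pair (idm (X ⊗ W)) pr2 ∘ s)
    = pr1 ∘ (pair (h fp) pr2 ∘ (idm munit ⊠ (copy _ ∘ s))) ∘ luniti X.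
  rewrite pr1_pairA /h -!compA (compA pr2) pr2_tensm -!compA.
  have -> : pr2 ∘ luniti X = idm X.
    by rewrite pr2E del_munit tensm_id comp_idr lunitiK.
  rewrite comp_idr.
  by rewrite (compA (_ ⊠ _)) copyE tensm_pair comp_idl comp_idr.
by rewrite !t e.
Qed.

Lemma trace_value_unique (C : markovCat) (X Y W : C) (f : X ⊗ W ~> Y ⊗ W)
    (t1 t2 : X ~> Y) :
  cancellative C -> atomic C -> trace_value f t1 -> trace_value f t2 -> t1 = t2.
Proof.
move=> canc at_C [fs1 [fp1 [d1 ->]]] [fs2 [fp2 [d2 ->]]].
have e : fs1 = fs2.
  apply: (cancel_pr1 (canc W)).
  by rewrite -(disintegration_signal d1) (disintegration_signal d2).
by subst fs2; apply: (trace_unique (at_C _ _ _) d1 d2).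
Qed.

(** * Existence of disintegrations from conditionals *)

Lemma disintegration_exists (C : markovCat) (X W' Y W : C) (f : X ⊗ W' ~> Y ⊗ W) :
  has_conditionals C -> non_signalling f ->
  exists fs fp, is_disintegration f fs fp.
Proof.
move=> cond [fs ns].
(* Non-signalling: the [W] marginal of [f] ignores [W'], so [fs] can serve as the signal. *)
have e : pr1 ∘ (swap Y W ∘ f) = fs ∘ pr1.
  rewrite swapE compA pr1_pair pr2E; move: ns; rewrite /marginal2 => ->.
  by rewrite -(pr1_tensm fs (idm W')) pr1E -compA -tensm_splitr.
(* Conditionals are taken given the first factor, hence the [swap]: [c] produces [Y] from the output
   [W] and the inputs [X ⊗ W']. *)
have [c] := cond _ _ _ (swap Y W ∘ f).
rewrite /is_conditional /marginal1 -pr1E e -(compA _ (_ ⊠ idm _)) -pairE => fE.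
(* [p] brings [X ⊗ W ⊗ W'] into the order [W ⊗ (X ⊗ W')] that [c] expects. *)
pose p := assoc W X W' ∘ (swap X W ⊠ idm W').
exists fs, (c ∘ p); apply/disintegrationE.
have -> : pair (c ∘ p) (pr2 ∘ pr1) = pair c pr1 ∘ p.
  have dp : det p by rewrite /p swapE assocE; auto 20.
  rewrite (pair_comp _ _ dp); congr (pair _ _); rewrite /p; struct.
rewrite -compA.
have -> : p ∘ (pair (idm X) fs ⊠ idm W') = pair (fs ∘ pr1) (idm (X ⊗ W')).
  rewrite /p -compA -tensm_comp swap_pair comp_idl tensm_pairE comp_idl.
  by rewrite pair_comp // comp_idl assoc_pair pair_eta.
rewrite -(comp_idl f) -(swapK Y W) -compA fE !compA; congr (_ ∘ _).
have -> : swap W Y ∘ (idm W ⊠ c) ∘ assoc W W (X ⊗ W') ∘ (copy W ⊠ idm (X ⊗ W'))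
          = swap W Y ∘ ((idm W ⊠ c) ∘ pair pr1 (idm _)).
  rewrite -!compA; congr (_ ∘ (_ ∘ _)); struct.
by rewrite tensm_pair swap_pair comp_idl comp_idr.
Qed.

(** * Superposition *)

Lemma trace_value_tensm (C : markovCat) (X Y W : C) (f : X ⊗ W ~> Y ⊗ W)
    (t : X ~> Y) (X' Y' : C) (g : X' ~> Y') :
  trace_value f t ->
  trace_value (associ Y' Y W ∘ (g ⊠ f) ∘ assoc X' X W) (g ⊠ t).
Proof.
move=> [fs [fp [/disintegrationE fE ->]]].
(* [r] only rebrackets, so that [g] meets [X'] and [fp] meets the other wires. *)
pose r : X' ⊗ X ⊗ W ⊗ W ~> X' ⊗ (X ⊗ W ⊗ W) :=
  assoc X' (X ⊗ W) W ∘ (assoc X' X W ⊠ idm W).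
(* The signal ignores [X'], so its graph is that of [fs] beside an idle wire. *)
have graphE : pair (idm (X' ⊗ X)) (fs ∘ pr2) = associ X' X W ∘ (idm X' ⊠ pair (idm X) fs).
  rewrite [in RHS]tensm_pairE comp_idl pair_comp // associ_pair comp_idl.
  by rewrite pair_eta.
exists (fs ∘ pr2), ((g ⊠ fp) ∘ r); split.
- apply/disintegrationE; rewrite graphE tensm_comp_idr.
  have e : (associ X' X W ⊠ idm W) ∘ ((idm X' ⊠ pair (idm X) fs) ⊠ idm W)
    = (associ X' X W ⊠ idm W) ∘ associ X' (X ⊗ W) W
      ∘ (idm X' ⊠ (pair (idm X) fs ⊠ idm W)) ∘ assoc X' X W.
    by rewrite -(compA _ (associ _ _ _)) associ_nat -!compA assocK comp_idr.
  (* [m] inverts [r] and is deterministic, so it can be pulled into the pairing, where it cancels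
     [r]. *)
  pose m := (associ X' X W ⊠ idm W) ∘ associ X' (X ⊗ W) W.
  have dm : det m by rewrite /m !associE; auto 20.
  have rm : r ∘ m = idm _.
    rewrite /r /m -compA (compA (assoc _ _ _ ⊠ _)) -tensm_comp_idr associK.
    by rewrite tensm_id comp_idl associK.
  have e2 : pair ((g ⊠ fp) ∘ r) (pr2 ∘ pr1) ∘ m
            = associ Y' Y W ∘ (g ⊠ pair fp (pr2 ∘ pr1)).
    rewrite (pair_comp _ _ dm) -(compA _ r) rm comp_idr.
    rewrite (tensm_pairE g (pair _ _)) pair_comp // associ_pair -tensm_pairE.
    congr (pair _ _); rewrite /m; struct.
  rewrite e -/m fE; clearbody m r.
  by rewrite !compA e2 -{1}(comp_idr g) tensm_comp !compA.
- rewrite !copy_signalE graphE -(compA _ r).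
  (* Up to the rebracketing [r], the copied signal of the tensor is that of [f] beside the idle wire
     [X']. *)
  have <- : (idm X' ⊠ pair (idm (X ⊗ W)) pr2) ∘ (idm X' ⊠ pair (idm X) fs)
     = r ∘ (pair (idm (X' ⊗ X ⊗ W)) pr2 ∘ (associ X' X W ∘ (idm X' ⊠ pair (idm X) fs))).
    rewrite !compA; congr (_ ∘ _); rewrite /r; struct.
  by rewrite -!tensm_comp !comp_idr.
Qed.

(** [epsilon] meets its specification because conditionals supply a disintegration, hence some trace
    value. *)
Lemma causal_traceP (C : markovCat) (X Y W : C) (f : X ⊗ W ~> Y ⊗ W) (hf : traceable f) :
  has_conditionals C -> trace_value f (causal_trace f hf).
Proof.
move=> cond; apply: epsilon_spec.
have [fs [fp d]] := disintegration_exists cond hf.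
by exists (fp ∘ copy_signal fs), fs, fp.
Qed.

Lemma disintegration_non_signalling (C : markovCat) (X W' Y W : C)
    (f : X ⊗ W' ~> Y ⊗ W) (fs : X ~> W) (fp : X ⊗ W ⊗ W' ~> Y) :
  is_disintegration f fs fp -> non_signalling f.
Proof.
move=> /disintegration_signal e; exists fs.
rewrite /marginal2 -pr2E e -(pr1_tensm fs (idm W')) pr1E -compA.
by rewrite -tensm_splitr.
Qed.

Theorem proposition24 (C : markovCat)
    (hcanc : cancellative C) (hatom : atomic C) (hcond : has_conditionals C)
    (X Y W : C) (f : X ⊗ W ~> Y ⊗ W) (hf : traceable f)
    (X' Y' : C) (g : X' ~> Y') :
  exists hgf : traceable (associ Y' Y W ∘ (g ⊠ f) ∘ assoc X' X W),
    causal_trace (associ Y' Y W ∘ (g ⊠ f) ∘ assoc X' X W) hgf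
    = g ⊠ causal_trace f hf.
Proof.
have tgf := trace_value_tensm g (causal_traceP hf hcond).
have hgf : traceable (associ Y' Y W ∘ (g ⊠ f) ∘ assoc X' X W).
  (* The disintegration behind [tgf] also witnesses traceability. *)
  by have [fs [fp [d _]]] := tgf; apply: disintegration_non_signalling d.
exists hgf; apply: (trace_value_unique hcanc hatom _ tgf).
exact: causal_traceP.
Qed.
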